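(* Let $K>0$, $N\in(0,\infty)$ and let $(X,d,m)$ be a metric measure space satisfying $\mathrm{CD}^e(K,N)$ with $m\in\mathcal P_2(X,d)$. Then for any $\mu\in\mathcal P_2(X,d,m)$ one has $W_2(\mu,m)\le\sqrt{\frac NK}\,\frac\pi2$ and $$\mathrm{Ent}(\mu)\ge-N\log\cos\left(\sqrt{\frac KN}\,W_2(\mu,m)\right).$$
   Context: The convention $-\log 0=+\infty$ is used. A metric measure space $(X,d,m)$ consists of a complete separable metric space $(X,d)$ and a locally finite, $\sigma$-finite Borel measure $m$ on $X$. $\mathcal P_2(X,d)$ is the set of Borel probability measures on $X$ with finite second moment; $\mathcal P_2(X,d,m)$ is its subset of measures absolutely continuous with respect to $m$; $W_2$ is the $L^2$-Wasserstein distance. $\mathrm{Ent}(\mu)=\int\rho\log\rho\,dm$ if $\mu=\rho m$ and $(\rho\log\rho)_+$ is $m$-integrable, and $\mathrm{Ent}(\mu)=+\infty$ otherwise; $\mathcal P_2^*(X,d,m)$ is the set of $\mu\in\mathcal P_2(X,d)$ with finite entropy; $U_N(\mu)=\exp(-\frac1N\mathrm{Ent}(\mu))$. For $\kappa>0$, $\theta\ge0$, $t\in[0,1]$: $\sigma_\kappa^{(t)}(\theta)=\sin(\sqrt\kappa t\theta)/\sin(\sqrt\kappa\theta)$ if $0<\kappa\theta^2<\pi^2$; $=t$ if $\theta=0$; $=+\infty$ if $\kappa\theta^2\ge\pi^2$. $\mathrm{CD}^e(K,N)$: for each pair $\mu_0,\mu_1\in\mathcal P_2^*(X,d,m)$ there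 is a constant speed $W_2$-geodesic $(\mu_t)_{t\in[0,1]}$ in $\mathcal P_2^*(X,d,m)$ from $\mu_0$ to $\mu_1$ such that for all $t\in[0,1]$: $U_N(\mu_t)\ge\sigma_{K/N}^{(1-t)}(W_2(\mu_0,\mu_1))\,U_N(\mu_0)+\sigma_{K/N}^{(t)}(W_2(\mu_0,\mu_1))\,U_N(\mu_1)$. *)

(* Defs.v *)
From HB Require Import structures.
From mathcomp Require Import all_boot all_order all_algebra.
From mathcomp Require Import all_classical all_reals all_analysis.

Set Implicit Arguments.
Unset Strict Implicit.
Unset Printing Implicit Defensive.

Import Order.TTheory GRing.Theory Num.Theory.
Import numFieldNormedType.Exports.

Local Open Scope classical_set_scope.
Local Open Scope ring_scope.
Local Open Scope ereal_scope.

#[short(type="completeMetricType")]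
HB.structure Definition CompleteMetric (R : numDomainType) :=
  {T of Complete T & Metric R T}.

Definition separable (X : topologicalType) :=
  exists2 S : set X, countable S & dense S.

Notation borel X := (g_sigma_algebraType (@open X)).

Section metric_measure.
Context {R : realType} {X : completeMetricType R}.

(* Measures are total set functions whose values on non-measurable sets carry
   no meaning, so two measures are compared on Borel sets only. *)
Definition eq_borel (mu nu : {measure set (borel X) -> \bar R}) :=
  forall A : set (borel X), measurable A -> mu A = nu A.

Definition locally_finite (m : {measure set (borel X) -> \bar R}) :=
  forall x : X, exists2 U : set X, open_nbhs x U & m U < +oo.

Definition P2 (mu : {measure set (borel X) -> \bar R}) :=
  mu setT = 1 /\
  exists x0 : X, \int[mu]_x ((@mdist R X x0 x) ^+ 2)%:E < +oo.

(* Since X is separable, the product sigma-algebra used here is the Borel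
   sigma-algebra of the product space. *)
Definition coupling (mu nu : {measure set (borel X) -> \bar R}) :
    set {measure set (borel X * borel X)%type -> \bar R} :=
  [set q | forall A : set (borel X), measurable A ->
     q (A `*` setT) = mu A /\ q (setT `*` A) = nu A].

Definition W2 (mu nu : {measure set (borel X) -> \bar R}) : \bar R :=
  sqrte (ereal_inf
    [set \int[q]_z ((@mdist R X z.1 z.2) ^+ 2)%:E | q in coupling mu nu]).

Definition geodesic (mu : R -> {measure set (borel X) -> \bar R}) :=
  forall s t : R, (0 <= s <= 1)%R -> (0 <= t <= 1)%R ->
    W2 (mu s) (mu t) = `|t - s|%:E * W2 (mu 0%R) (mu 1%R).

Variable m : {measure set (borel X) -> \bar R}.

Definition P2ac (mu : {measure set (borel X) -> \bar R}) :=
  P2 mu /\ mu `<< m.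

Definition density (mu : {measure set (borel X) -> \bar R})
    (rho : borel X -> R) :=
  [/\ measurable_fun setT rho, forall x, (0 <= rho x)%R &
      forall A, measurable A -> mu A = \int[m]_(x in A) (rho x)%:E].

(* The set below has at most one element when m is sigma-finite, a density
   being unique m-almost everywhere.  The library's [ln] satisfies
   [ln 0 = 0], so the integrand vanishes where rho does; the integral is -oo
   when the negative part is not integrable. *)
Definition Ent (mu : {measure set (borel X) -> \bar R}) : \bar R :=
  xget +oo
    [set \int[m]_x (rho x * ln (rho x))%:E | rho in
      [set rho | density mu rho /\
         m.-integrable setT (fun x => (Num.max (rho x * ln (rho x)) 0)%:E)]].

Definition P2star (mu : {measure set (borel X) -> \bar R}) :=
  P2 mu /\ Ent mu \is a fin_num.

Definition U (N : R) (mu : {measure set (borel X) -> \bar R}) : \bar R :=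
  expeR (- (N^-1%:E * Ent mu)).

End metric_measure.

(* Meaningful for kappa > 0, theta >= 0 and t in [0, 1]. *)
Definition sigma {R : realType} (kappa t theta : R) : \bar R :=
  if theta == 0%R then t%:E
  else if (pi ^+ 2 <= kappa * theta ^+ 2)%R then +oo
  else (sin (Num.sqrt kappa * t * theta) / sin (Num.sqrt kappa * theta))%:E.

(* Meaningful for K > 0 and N > 0, because of [sigma]. *)
Definition CDe {R : realType} {X : completeMetricType R}
    (m : {measure set (borel X) -> \bar R}) (K N : R) :=
  forall mu0 mu1 : {measure set (borel X) -> \bar R},
    P2star m mu0 -> P2star m mu1 ->
    exists mu : R -> {measure set (borel X) -> \bar R},
      [/\ eq_borel (mu 0%R) mu0, eq_borel (mu 1%R) mu1, geodesic mu,
          forall t : R, (0 <= t <= 1)%R -> P2star m (mu t) &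
          forall t : R, (0 <= t <= 1)%R ->
            sigma (K / N) (1 - t) (fine (W2 mu0 mu1)) * U m N mu0
            + sigma (K / N) t (fine (W2 mu0 mu1)) * U m N mu1
            <= U m N (mu t)].

(* Main.v *)
(** With [a = sqrt (K / N) * W2 mu m], the CD^e inequality between mu and m, the
    normalisation Ent m = 0 and Jensen's inequality Ent mu_t >= 0 give
    [sin ((1 - t) a) U mu + sin (t a) <= sin a]; letting t tend to 1 yields
    [U mu <= cos a], which is the entropy bound and, since U mu > 0, forces
    [a < pi / 2].  If Ent mu is infinite, mu is conditioned on the sublevel sets
    of its density: the conditioned measures have finite entropy, and a
    near-optimal coupling of one of them with m, completed by the product
    coupling on the small remaining mass, is a coupling of mu and m.  So the
    distance bound passes to mu without gluing or semicontinuity. *)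
Require Import Defs.
From HB Require Import structures.
From mathcomp Require Import all_boot all_order all_algebra.
From mathcomp Require Import all_classical all_reals all_analysis.
From mathcomp Require Import measurable_realfun lra ring.

Set Implicit Arguments.
Unset Strict Implicit.
Unset Printing Implicit Defensive.

Import Order.TTheory GRing.Theory Num.Theory.
Import numFieldNormedType.Exports.

Local Open Scope classical_set_scope.
Local Open Scope ring_scope.
Local Open Scope ereal_scope.

(** * Repackaging of measures and real-variable inequalities *)

Lemma probability_eq d (T : measurableType d) (R : realType)
    (mu : {measure set T -> \bar R}) : mu setT = 1 ->
  exists P : probability T R, (P : {measure set T -> \bar R}) = mu.
Proof.
(* Once [mu] is opened, the rebuilt bundle is convertible to it, so the equality relates whole
   structures and can be used to rewrite. *)
case: mu => mu [h1 h2].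
pose mu0 : {measure set T -> \bar R} := Measure.Pack (@Measure.Class _ _ _ _ h1 h2).
move=> mu01.
pose P : probability T R := HB.pack_for (probability T R) (Measure.sort mu0)
  (Measure_isProbability.Build _ _ _ mu0 mu01).
by exists P.
Qed.

(** At [t = 1 - 2b/a] the sines become those of [2b], [(a - b) - b] and [(a - b) + b]; expanding and
    cancelling [2 sin b] leaves [u cos b <= cos (a - b)]. Letting [b] tend to 0 replaces
    differentiation at [t = 1]. *)
Lemma le_cos_of_sin_concavity (R : realType) (a u : R) : (0 < a)%R ->
    (forall t : R, (0 < t < 1)%R ->
      (sin ((1 - t) * a) * u + sin (t * a) <= sin a)%R) ->
  (u <= cos a)%R.
Proof.
move=> a0 H; rewrite leNgt; apply/negP => au.
pose g (s : R) : R := (cos (a - s) - u * cos s)%R.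
have cg : {for 0%R, continuous g}.
  apply: continuousB.
    apply: (@continuous_comp _ _ _ (fun s : R => (a - s)%R) (@cos R)); last exact: continuous_cos.
    by apply: continuousB; [exact: cst_continuous|exact: cvg_id].
  by apply: continuousM; [exact: cst_continuous|exact: continuous_cos].
have g0 : (g 0 < 0)%R by rewrite /g subr0 cos0 mulr1 subr_lt0.
have /nbhs_ballP[e /= e0 eP] : \forall s \near 0%R, (g s < 0)%R.
  exact: (@cvgr_lt R R (nbhs (0%R:R)) _ g (g 0%R) cg 0%R g0).
(* The three bounds respectively keep [t] in [(0, 1)], keep [b] in the ball where [g < 0], and make
   [sin b] positive. *)
pose b := (Num.min (a / 4) (Num.min (e / 2) 1))%R.
have b0 : (0 < b)%R by rewrite !lt_min !divr_gt0//=.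
have [ba be b1] : [/\ b <= a / 4, b <= e / 2 & b <= 1]%R.
  by rewrite /b !ge_min !lexx ?orbT.
have : (g b < 0)%R.
  by apply: eP; rewrite /ball/= sub0r normrN gtr0_norm//; lra.
have sb : (0 < sin b)%R.
  apply: sin_gt0_pi; rewrite b0/=; apply: (le_lt_trans b1).
  by have := @pi_ge2 R; lra.
have := H (1 - (b *+ 2) / a)%R.
have -> : ((1 - (1 - b *+ 2 / a)) * a = b *+ 2)%R.
  by rewrite opprB addrC subrK divfK// gt_eqF.
have -> : ((1 - b *+ 2 / a) * a = (a - b) - b)%R.
  by rewrite mulrBl mul1r divfK ?gt_eqF// mulr2n opprD addrA.
have -> : sin a = sin ((a - b) + b)%R by rewrite subrK.
rewrite sin_mulr2n (sinB (a - b)) (sinD (a - b)) /g.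
have -> : (0 < 1 - b *+ 2 / a < 1)%R.
  rewrite gtrBl divr_gt0 ?pmulrn_lgt0// andbT subr_gt0 ltr_pdivrMr// mul1r.
  by rewrite mulr2n; lra.
move=> /(_ isT) h1 h2; rewrite mulr2n in h1.
have : (sin b * (cos (a - b) - u * cos b) < 0)%R by rewrite pmulr_rlt0.
lra.
Qed.

(** This is [ln (1 + y) <= y] at [y = 1/x - 1], multiplied by [x]; at [x = 0] it reads [-1 <= 0]. *)
Lemma subr1_le_xlnx (R : realType) (x : R) : (0 <= x)%R -> (x - 1 <= x * ln x)%R.
Proof.
rewrite le_eqVlt => /predU1P[<-|x0]; first by rewrite mul0r; lra.
have := @le_ln1Dx R (x^-1 - 1)%R.
rewrite addrCA subrr addr0 lnV ?posrE// => h.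
have {}h : (- ln x <= x^-1 - 1)%R.
  by apply: h; rewrite ltrBrDl subrr invr_gt0.
have := ler_wpM2l (ltW x0) h.
rewrite mulrBr mulfV ?gt_eqF// mulr1; lra.
Qed.

(** The negative part is at most 1 because [x ln x >= x - 1 >= -1], and constants are integrable for
    a probability. *)
Lemma integrable_xlnx d (T : measurableType d) (R : realType)
    (P : probability T R)
    (rho : T -> R) : measurable_fun setT rho -> (forall x, 0 <= rho x)%R ->
    P.-integrable setT (fun x => (Num.max (rho x * ln (rho x)) 0)%:E) ->
  P.-integrable setT (fun x => (rho x * ln (rho x))%:E).
Proof.
move=> mrho rho0 hint.
have h1 : P.-integrable setT (cst 1 : T -> \bar R).
  exact: finite_measure_integrable_cst.
apply: (le_integrable _ _ _ (integrableD measurableT hint h1)) => //.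
  apply/measurable_EFinP; apply: measurable_funM => //.
  by apply: measurableT_comp => //; exact: measurable_ln.
move=> x _; rewrite /= lee_fin.
have := subr1_le_xlnx (rho0 x); have := rho0 x => r0 h.
rewrite [leRHS]ger0_norm; last by rewrite addr_ge0// le_max lexx orbT.
rewrite ler_norml -lerBlDr opprD; apply/andP; split.
  have : (0 <= Num.max (rho x * ln (rho x)) 0)%R by rewrite le_max lexx orbT.
  by lra.
have : (rho x * ln (rho x) <= Num.max (rho x * ln (rho x)) 0)%R by rewrite le_max lexx.
by lra.
Qed.

(* Jensen's inequality, through x ln x >= x - 1. *)
Lemma integral_xlnx_ge0 d (T : measurableType d) (R : realType)
    (P : probability T R)
    (rho : T -> R) : measurable_fun setT rho -> (forall x, 0 <= rho x)%R ->
    \int[P]_x (rho x)%:E = 1 ->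
    P.-integrable setT (fun x => (rho x * ln (rho x))%:E) ->
  0 <= \int[P]_x (rho x * ln (rho x))%:E.
Proof.
move=> mrho rho0 rho1 hint.
have h1 : P.-integrable setT (cst 1 : T -> \bar R).
  exact: finite_measure_integrable_cst.
have hrho : P.-integrable setT (EFin \o rho).
  apply/integrableP; split; first exact/measurable_EFinP.
  under eq_integral do rewrite /= ger0_norm//.
  by rewrite rho1 ltry.
have i1 : \int[P]_x cst 1 x = 1.
  by rewrite integral_cst// mul1e; exact: probability_setT.
have i0 : \int[P]_x ((EFin \o rho) \- cst 1) x = 0.
  by rewrite integralB// i1 rho1 subee.
rewrite -i0; apply: le_integral => //; first exact: integrableB.
by move=> x _; rewrite /= -EFinB lee_fin subr1_le_xlnx.
Qed.

(** * Entropy relative to a probability measure *)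

Section entropy.
Context {R : realType} {X : completeMetricType R}.
Variable m : probability (borel X) R.
Implicit Types (mu : {measure set (borel X) -> \bar R}) (rho : borel X -> R).

Lemma Ent_ge0 mu : mu setT = 1 -> 0 <= Ent m mu.
Proof.
move=> mu1; rewrite /Ent; case: xgetP => [y _ [rho [[mrho rho0 rhoE] hint] <-]|//].
apply: integral_xlnx_ge0 => //; first by rewrite -rhoE.
exact: integrable_xlnx.
Qed.

Lemma Ent_fin_num mu rho : density m mu rho ->
    m.-integrable setT (fun x => (Num.max (rho x * ln (rho x)) 0)%:E) ->
  Ent m mu \is a fin_num.
Proof.
move=> drho hrho; rewrite /Ent; case: xgetP => [y _ [g [[mg g0 gE] hint] <-]|].
  by apply: integrable_fin_num => //; exact: integrable_xlnx.
by move=> /(_ (\int[m]_x (rho x * ln (rho x))%:E)) []; exists rho.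
Qed.

Lemma density_self : density m m (cst 1%R).
Proof.
split => // A mA; transitivity (\int[m]_(x in A) cst 1 x) => //.
by rewrite integral_cst// mul1e.
Qed.

(** [xget] may pick any density of [m], but each equals 1 almost everywhere, where [rho ln rho]
    vanishes. The constant density excludes the default [+oo]. *)
Lemma Ent_self : Ent m m = 0.
Proof.
rewrite /Ent; case: xgetP => [y _ [rho [[mrho rho0 rhoE] hint] <-]|]; last first.
  move=> /(_ (\int[m]_x (1 * ln 1)%:E)) []; exists (cst 1%R) => //; split; first exact: density_self.
  under [X in _.-integrable _ X]eq_fun do rewrite /= ln1 mulr0 maxxx.
  exact: integrable0.
have ae1 : ae_eq m setT (cst 1) (EFin \o rho).
  apply: integral_ae_eq => //.
  - exact: finite_measure_integrable_cst.
  - exact/measurable_EFinP.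
  - by move=> E _ mE; rewrite -rhoE// integral_cst// mul1e.
rewrite (ae_eq_integral (cst 0))//.
- by rewrite integral0.
- apply/measurable_EFinP; apply: measurable_funM => //.
  by apply: measurableT_comp => //; exact: measurable_ln.
- apply: filterS ae1 => x /(_ I) [/esym /= ->] _; by rewrite ln1 mulr0.
Qed.

(** The positive part of [rho ln rho] is dominated by the constant [M |ln M|]. This gives the
    conditioned measures finite entropy. *)
Lemma Ent_bounded mu rho (M : R) : density m mu rho -> (forall x, rho x <= M)%R ->
  Ent m mu \is a fin_num.
Proof.
move=> drho rhoM; apply: (Ent_fin_num drho); case: drho => mrho rho0 _.
have h1 : m.-integrable setT (cst (M * `|ln M|)%:E).
  exact: finite_measure_integrable_cst.
apply: le_integrable h1 => //.
  apply/measurable_EFinP; apply: measurable_maxr => //.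
  apply: measurable_funM => //.
  by apply: measurableT_comp => //; exact: measurable_ln.
move=> x _; rewrite lee_fin.
have M0 : (0 <= M)%R := le_trans (rho0 x) (rhoM x).
rewrite [leRHS]ger0_norm ?mulr_ge0// [leLHS]ger0_norm ?le_max ?lexx ?orbT//.
rewrite ge_max mulr_ge0// andbT.
have := rho0 x; rewrite le_eqVlt => /predU1P[<-|r0].
  by rewrite mul0r mulr_ge0.
apply: (@le_trans _ _ (rho x * `|ln M|)%R); last exact: ler_wpM2r.
rewrite ler_wpM2l// (le_trans _ (ler_norm _))// ler_ln// ?posrE//.
exact: lt_le_trans (rhoM x).
Qed.

End entropy.

(** * Measurability of the distance and finiteness of the transport cost *)

Lemma mdist_ball_open (R : realType) (X : metricType R) (x : X) (r : R) :
  open [set y | (mdist x y < r)%R].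
Proof.
rewrite openE => y /= xy; rewrite /interior; apply/nbhs_ballP.
exists (r - mdist x y)%R; first by rewrite /= subr_gt0.
rewrite ballEmdist => z /= yz.
by apply: (le_lt_trans (metric_triangle x y z)); rewrite -ltrBrDl.
Qed.

Lemma ge0_integral_mrestr d (T : measurableType d) (R : realType)
    (mu : {measure set T -> \bar R}) (D : set T) (mD : measurable D)
    (f : T -> \bar R) : measurable_fun setT f -> (forall x, 0 <= f x) ->
  \int[mrestr mu mD]_x f x = \int[mu]_(x in D) f x.
Proof.
move=> mf f0; have mDc := measurableC mD.
rewrite -(setUv D) ge0_integral_setU ?setUv//; last exact/disj_set2P/setICr.
rewrite [X in _ + X]null_set_integral ?adde0//; last 2 first.
- exact: measurable_funTS.
- by rewrite /= /mrestr setICl measure0.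
apply: eq_measure_integral => A mA AD.
by rewrite /mrestr; congr (mu _); exact/setIidPl.
Qed.

Section transport.
Context {R : realType} {X : completeMetricType R}.
Hypothesis sepX : separable X.
Local Notation dist := (@mdist R X).
Local Notation cost q := (\int[q]_z ((dist z.1 z.2) ^+ 2)%:E).
Implicit Types (mu nu : {measure set (borel X) -> \bar R}).

Lemma measurable_mdist (x : X) : measurable_fun [set: borel X] (dist x).
Proof.
move=> mT; apply: (measurability _ (RGenInftyO.measurableE R)) => // _ [_ [r ->] <-].
rewrite setTI; apply: sub_sigma_algebra.
rewrite [X in open X](_ : _ = [set y | (dist x y < r)%R]); first exact: mdist_ball_open.
by apply/seteqP; split => y /=; rewrite in_itv.
Qed.

(** The set [d(x, y) < r] is the union, over [s] in a countable dense set, of the sets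
    [d(s, x) + d(s, y) < r], each measurable for the product sigma-algebra. *)
Lemma measurable_mdist2 :
  measurable_fun [set: (borel X * borel X)%type] (fun z => dist z.1 z.2).
Proof.
have [S cS dS] := sepX.
move=> mT; apply: (measurability _ (RGenInftyO.measurableE R)) => // _ [_ [r ->] <-].
rewrite setTI [X in measurable X](_ : _ = \bigcup_(s in [set: S])
    [set z : borel X * borel X | (dist (val s) z.1 + dist (val s) z.2 < r)%R]).
  apply: countable_bigcupT_measurable => [|s].
    by rewrite (eq_countable (card_setT _)).
  pose h (z : borel X * borel X) := (dist (val s) z.1 + dist (val s) z.2)%R.
  have mh : measurable_fun setT h.
    apply: measurable_funD.
      by apply: measurableT_comp measurable_fst; exact: measurable_mdist.
    by apply: measurableT_comp measurable_snd; exact: measurable_mdist.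
  rewrite -(preimage_itvNyo h) -[X in measurable X]setTI.
  exact: mh (measurable_itv _).
apply/seteqP; split => [[x y]/=|[x y] [s _] /=]; rewrite in_itv/= => xyr.
  (* If [d(x, s) < e], then [d(s, x) + d(s, y) <= 2 d(x, s) + d(x, y) < r]. *)
  pose e := ((r - dist x y) / 2)%R.
  have e0 : (0 < e)%R by rewrite divr_gt0// subr_gt0.
  have [s [/= xs Ss]] : [set z | (dist x z < e)%R] `&` S !=set0.
    by apply: dS; [exists x; rewrite /= mdistxx|exact: mdist_ball_open].
  exists (SigSub (mem_set Ss)) => //=.
  have := metric_triangle s x y; move: xs xyr; rewrite (metric_sym s x) /e.
  by move: (dist x s) (dist s y) (dist x y) => a b c; lra.
apply: le_lt_trans xyr; rewrite (metric_sym (val s) x).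
exact: metric_triangle.
Qed.

Lemma measurable_sqr_mdist (x : X) :
  measurable_fun [set: borel X] (fun y => ((dist x y) ^+ 2)%:E).
Proof.
by apply/measurable_EFinP; apply: measurable_funX; exact: measurable_mdist.
Qed.

Lemma measurable_cost :
  measurable_fun [set: (borel X * borel X)%type] (fun z => ((dist z.1 z.2) ^+ 2)%:E).
Proof.
by apply/measurable_EFinP; apply: measurable_funX; exact: measurable_mdist2.
Qed.

Lemma cost_ge0 (z : borel X * borel X) : 0 <= ((dist z.1 z.2) ^+ 2)%:E.
Proof. by rewrite lee_fin sqr_ge0. Qed.

Lemma coupling_integral_fst mu nu q (f : borel X -> \bar R) : coupling mu nu q ->
    measurable_fun setT f -> (forall x, 0 <= f x) ->
  \int[q]_z f z.1 = \int[mu]_x f x.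
Proof.
move=> qc mf f0.
rewrite -(ge0_integral_pushforward (@measurable_fst _ _ (borel X) (borel X)) q _ mf)//.
apply: eq_measure_integral => A mA _; rewrite /pushforward -(qc A mA).1.
by congr (q _); apply/seteqP; split => z //= -[].
Qed.

Lemma coupling_integral_snd mu nu q (f : borel X -> \bar R) : coupling mu nu q ->
    measurable_fun setT f -> (forall x, 0 <= f x) ->
  \int[q]_z f z.2 = \int[nu]_x f x.
Proof.
move=> qc mf f0.
rewrite -(ge0_integral_pushforward (@measurable_snd _ _ (borel X) (borel X)) q _ mf)//.
apply: eq_measure_integral => A mA _; rewrite /pushforward -(qc A mA).2.
by congr (q _); apply/seteqP; split => z //= -[].
Qed.

(** The path through [x0] and [y0] and [(a + b + c)^2 <= 3 (a^2 + b^2 + c^2)] bound the cost by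
    [f z.1 + g z.2], which integrates against the marginals. *)
Lemma cost_lty mu nu q : coupling mu nu q -> P2 mu -> P2 nu -> cost q < +oo.
Proof.
move=> qc [mu1 [x0 hx0]] [nu1 [y0 hy0]].
pose f (x : borel X) : \bar R := (3 * (dist x0 x ^+ 2 + dist x0 y0 ^+ 2))%:E.
pose g (x : borel X) : \bar R := (3 * (dist y0 x ^+ 2))%:E.
have mf : measurable_fun setT f.
  apply/measurable_EFinP; apply: measurable_funM => //.
  apply: measurable_funD => //; apply: measurable_funX; exact: measurable_mdist.
have mg : measurable_fun setT g.
  apply/measurable_EFinP; apply: measurable_funM => //.
  apply: measurable_funX; exact: measurable_mdist.
have f0 x : 0 <= f x by rewrite lee_fin mulr_ge0// addr_ge0// sqr_ge0.
have g0 x : 0 <= g x by rewrite lee_fin mulr_ge0// sqr_ge0.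
have mf1 : measurable_fun setT (fun z : borel X * borel X => f z.1).
  by apply: measurableT_comp => //; exact: measurable_fst.
have mg2 : measurable_fun setT (fun z : borel X * borel X => g z.2).
  by apply: measurableT_comp => //; exact: measurable_snd.
apply: (@le_lt_trans _ _ (\int[q]_z (f z.1 + g z.2))).
  apply: ge0_le_integral => //.
  - by move=> z _; exact: cost_ge0.
  - exact: measurable_cost.
  - exact: emeasurable_funD.
  - move=> z _; rewrite /f /g -EFinD lee_fin.
    have h1 := metric_triangle z.1 x0 z.2; have h2 := metric_triangle x0 y0 z.2.
    rewrite (metric_sym z.1 x0) in h1.
    have := mdist_ge0 z.1 z.2; have := mdist_ge0 x0 z.1.
    have := mdist_ge0 x0 y0; have := mdist_ge0 y0 z.2.
    move: h1 h2; move: (dist z.1 z.2) (dist x0 z.1) (dist x0 y0) (dist y0 z.2) (dist x0 z.2).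
    move=> w a b c e h1 h2 c0 b0 a0 w0.
    have : (w ^+ 2 <= (a + b + c) ^+ 2)%R by rewrite ler_sqr ?nnegrE; lra.
    have := sqr_ge0 (a - b)%R; have := sqr_ge0 (b - c)%R; have := sqr_ge0 (a - c)%R.
    by rewrite !expr2; lra.
rewrite ge0_integralD// (coupling_integral_fst qc)// (coupling_integral_snd qc)//.
rewrite lte_add_pinfty//.
  rewrite /f; under eq_integral do rewrite EFinM.
  rewrite ge0_integralZl_EFin//; last 2 first.
  - by move=> x _; rewrite lee_fin addr_ge0// sqr_ge0.
  - apply/measurable_EFinP; apply: measurable_funD => //.
    by apply: measurable_funX; exact: measurable_mdist.
  rewrite lte_mul_pinfty//; under eq_integral do rewrite EFinD.
  rewrite ge0_integralD//; last 3 first.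
  - by move=> x _; rewrite lee_fin sqr_ge0.
  - exact: measurable_sqr_mdist.
  - by move=> x _; rewrite lee_fin sqr_ge0.
  rewrite lte_add_pinfty// (_ : \int[mu]_x _ = \int[mu]_x cst ((dist x0 y0 ^+ 2)%:E) x)//.
  by rewrite integral_cst// [X in _ * X]mu1 mule1 ltry.
rewrite /g; under eq_integral do rewrite EFinM.
rewrite ge0_integralZl_EFin//; last 2 first.
- by move=> x _; rewrite lee_fin sqr_ge0.
- exact: measurable_sqr_mdist.
by rewrite lte_mul_pinfty.
Qed.

Lemma coupling_product (P Q : probability (borel X) R) : coupling P Q (P \x Q).
Proof.
move=> A mA; split.
  apply: etrans (product_measure1E P Q mA measurableT) _.
  by rewrite [X in _ * X]probability_setT mule1.
apply: etrans (product_measure1E P Q measurableT mA) _.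
by rewrite [X in X * _]probability_setT mul1e.
Qed.

Lemma W2_ge0 mu nu : 0 <= W2 mu nu. Proof. exact: sqrte_ge0. Qed.

(** The product coupling has finite cost. Hence [fine (W2 P Q)] is the genuine distance. *)
Lemma W2_fin_num (P Q : probability (borel X) R) : P2 P -> P2 Q ->
  W2 P Q \is a fin_num.
Proof.
move=> p2P p2Q; rewrite /W2 sqrte_fin_num; last first.
  by apply: le_ereal_inf_tmp => _ [q _ <-]; apply: integral_ge0 => z _; exact: cost_ge0.
rewrite ge0_fin_numE; last first.
  by apply: le_ereal_inf_tmp => _ [q _ <-]; apply: integral_ge0 => z _; exact: cost_ge0.
apply: le_lt_trans (cost_lty (@coupling_product P Q) p2P p2Q).
by apply: ereal_inf_lbound; exists (P \x Q) => //; exact: coupling_product.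
Qed.

End transport.

(** * Conditioning a measure on a set *)

Section conditional_measure.
Context d (T : measurableType d) (R : realType).
Variables (mu : {measure set T -> \bar R}) (A : set T) (mA : measurable A).

Lemma fine_measure_ge0 : (0 <= fine (mu A))%R.
Proof. exact/fine_ge0/measure_ge0. Qed.

Lemma fine_measure_inv_ge0 : (0 <= (fine (mu A))^-1)%R.
Proof. by rewrite invr_ge0 fine_measure_ge0. Qed.

(** If [mu A] is 0 or [+oo], the factor is 0 and this is the zero measure. *)
Definition cond_measure : {measure set T -> \bar R} :=
  mscale (NngNum fine_measure_inv_ge0) (mrestr mu mA).

Lemma cond_measureE B : cond_measure B = (fine (mu A))^-1%:E * mu (B `&` A).
Proof. by []. Qed.

Lemma cond_measureT : 0 < mu A < +oo -> cond_measure setT = 1.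
Proof.
move=> /andP[A0 Aoo]; rewrite cond_measureE setTI.
have fA : mu A \is a fin_num by rewrite ge0_fin_numE// ltW.
rewrite -{2}(fineK fA) -EFinM mulVf// gt_eqF//.
by rewrite fine_gt0// A0.
Qed.

Lemma ge0_integral_cond_measure (f : T -> \bar R) : measurable_fun setT f ->
    (forall x, 0 <= f x) ->
  \int[cond_measure]_x f x = (fine (mu A))^-1%:E * \int[mu]_(x in A) f x.
Proof. by move=> mf f0; rewrite ge0_integral_mscale//= ge0_integral_mrestr. Qed.

End conditional_measure.

(** * Passing a distance bound from conditioned measures to the whole measure *)

Section truncation.
Context {R : realType} {X : completeMetricType R}.
Hypothesis sepX : separable X.
Local Notation dist := (@mdist R X).
Local Notation cost q := (\int[q]_z ((dist z.1 z.2) ^+ 2)%:E).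
Implicit Types (P Q : probability (borel X) R).

(* A coupling of the conditioned measure is completed into a coupling of P by
   the product coupling on the remaining mass. *)
Lemma coupling_mix P Q (A : set (borel X)) (mA : measurable A)
    (mAc : measurable (~` A `*` [set: borel X])) q : 0 < P A ->
    coupling (cond_measure P mA) Q q ->
  coupling P Q (measure_add (mscale (NngNum (fine_measure_ge0 P A)) q)
    (mrestr (P \x Q) mAc)).
Proof.
move=> PA0 qc B mB.
have fA : P A \is a fin_num by exact: fin_num_measure.
have PA : P A + P (~` A) = 1.
  rewrite -measureU//; last by rewrite setICr.
    by rewrite setUv; exact: probability_setT.
  exact: measurableC.
split; apply: etrans (measure_addE _ _ _) _; rewrite /= /mscale /mrestr /=.
(* First marginal: the weight [P A] cancels the normalisation, leaving [P (B & A) + P (B & ~A)],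
   where [&] is intersection. *)
- rewrite (qc B mB).1 -setXI setTI (product_measure1E P Q (measurableI _ _ mB (measurableC mA)) measurableT).
  rewrite [X in _ + _ * X]probability_setT mule1 cond_measureE muleA -EFinM.
  rewrite mulfV ?mul1e; last by rewrite gt_eqF// fine_gt0// PA0 ltey_eq fA.
  rewrite -measureU//; last by rewrite setIACA setICr setI0.
  - by rewrite -setIUr setUv setIT.
  - exact: measurableI.
  - by apply: measurableI => //; exact: measurableC.
(* Second marginal: [(P A + P (~A)) Q B]. *)
- rewrite (qc B mB).2 -setXI setTI setIT (product_measure1E P Q (measurableC mA) mB).
  by rewrite fineK// -ge0_muleDl// PA mul1e.
Qed.

(** The product coupling has finite cost, so its cost over the complement of [F n] is at most
    [e / 2] for large [n]. Mixing it there with a coupling of the conditioned measure of cost below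
    [D^2 + e / 2] costs at most [D^2 + e]. *)
Lemma W2_le_of_cond P Q (D : R) (F : (set (borel X))^nat)
    (mF : forall n, measurable (F n)) : P2 P -> P2 Q -> (0 <= D)%R ->
    nondecreasing_seq F -> \bigcup_n F n = setT ->
    (forall n, 0 < P (F n) -> W2 (cond_measure P (mF n)) Q <= D%:E) ->
  W2 P Q <= D%:E.
Proof.
move=> p2P p2Q D0 ndF UF hW.
have DE : D%:E = sqrte (D ^+ 2)%:E by rewrite /= sqrtr_sqr ger0_norm.
have D20 : (0 <= D ^+ 2)%R by rewrite sqr_ge0.
rewrite DE lee_sqrt ?lee_fin//; apply/lee_addgt0Pr => e e0.
pose q0 : {measure set (borel X * borel X)%type -> \bar R} := P \x Q.
have mFX n : measurable (F n `*` [set: borel X]) by exact: measurableX.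
have mFcX n : measurable (~` F n `*` [set: borel X]).
  by apply: measurableX => //; exact: measurableC.
have mc := measurable_cost sepX.
have c0 := @cost_ge0 R X.
have cq0 : cost q0 \is a fin_num.
  rewrite ge0_fin_numE; last by apply: integral_ge0 => z _; exact: c0.
  exact: (cost_lty sepX (coupling_product P Q)).
have h1 : \int[q0]_(z in F n `*` [set: borel X]) ((dist z.1 z.2) ^+ 2)%:E
    @[n --> \oo] --> cost q0.
  rewrite [X in _ --> integral _ X _](_ : _ =
      \bigcup_n (F n `*` [set: borel X])); last first.
    apply/seteqP; split => // z _.
    have : (\bigcup_n F n) z.1 by rewrite UF.
    by case=> n _ Fn; exists n.
  apply: ge0_nondecreasing_set_cvg_integral => //.
  - move=> i j ij; apply/subsetPset => z [Fz _]; split => //.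
    by move/subsetPset: (ndF _ _ ij); exact.
  - by move=> n; exact: measurable_funTS.
have h2 : P (F n) @[n --> \oo] --> 1.
  rewrite -[1](probability_setT P) -UF; apply: nondecreasing_cvg_mu => //.
  exact: bigcupT_measurable.
have n1 : \forall n \near \oo, cost q0 - (e / 2)%:E <
    \int[q0]_(z in F n `*` [set: borel X]) ((dist z.1 z.2) ^+ 2)%:E.
  apply: (h1 _ (open_ereal_gt' _)).
  by rewrite -(fineK cq0) -EFinB lte_fin ltrBlDr ltrDl divr_gt0.
have n2 : \forall n \near \oo, 0 < P (F n).
  exact: (h2 _ (open_ereal_gt' (@lte01 R))).
have [n [hn PFn]] : exists n, cost q0 - (e / 2)%:E <
    \int[q0]_(z in F n `*` [set: borel X]) ((dist z.1 z.2) ^+ 2)%:E /\ 0 < P (F n).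
  by near \oo => n; exists n; split; near: n.
have := hW n PFn; rewrite DE lee_sqrt ?lee_fin// => {}hW.
have : ereal_inf [set cost q | q in coupling (cond_measure P (mF n)) Q]
    < (D ^+ 2 + e / 2)%:E.
  by rewrite (le_lt_trans hW)// lte_fin ltrDl divr_gt0.
move=> /ereal_inf_lt[_ [q qc <-] hq].
pose mix : {measure set (borel X * borel X)%type -> \bar R} := measure_add
  (mscale (NngNum (fine_measure_ge0 P (F n))) q) (mrestr q0 (mFcX n)).
apply: ge_ereal_inf; exists (cost mix); first by exists mix => //; exact: coupling_mix.
rewrite ge0_integral_measure_add// ge0_integral_mscale//= ge0_integral_mrestr//.
have PF1 : (fine (P (F n)) <= 1)%R.
  by rewrite -lee_fin fineK ?fin_num_measure// probability_le1.
have cq : 0 <= cost q by apply: integral_ge0 => z _; exact: c0.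
apply: (@le_trans _ _ ((D ^+ 2 + e / 2)%:E + (e / 2)%:E)); last first.
  by rewrite -!EFinD -addrA -splitr.
apply: leeD.
  rewrite (le_trans _ (ltW hq))// -[leRHS]mul1e lee_wpmul2r//.
have split0 : cost q0 = \int[q0]_(z in F n `*` [set: borel X]) ((dist z.1 z.2) ^+ 2)%:E
   + \int[q0]_(z in ~` F n `*` [set: borel X]) ((dist z.1 z.2) ^+ 2)%:E.
  rewrite -ge0_integral_setU//.
  - rewrite (_ : _ `|` _ = setT)//; apply/seteqP; split => // z _.
    by have [?|?] := pselect (F n z.1); [left|right].
  - exact: measurable_funTS.
  - apply/disj_set2P; apply/seteqP; split => // z [[Fz _] [Fz' _]].
    exact: Fz'.
have I0 : 0 <= \int[q0]_(z in F n `*` [set: borel X]) ((dist z.1 z.2) ^+ 2)%:E.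
  by apply: integral_ge0 => z _; exact: c0.
have J0 : 0 <= \int[q0]_(z in ~` F n `*` [set: borel X]) ((dist z.1 z.2) ^+ 2)%:E.
  by apply: integral_ge0 => z _; exact: c0.
(* With both pieces finite, [(I + J) - e / 2 < I] yields [J <= e / 2]. *)
move: hn cq0; rewrite split0 fin_numD => + /andP[fI fJ].
move: fI fJ; case: (integral _ _ _) => // i _; case: (integral _ _ _) => // j _.
by rewrite lte_fin lee_fin; lra.
Unshelve. all: by end_near.
Qed.

End truncation.

(** * From the distortion inequality to the cosine bound *)

Section distortion.
Context {R : realType}.
Variables (kappa u w : R).
Hypotheses (kappa_gt0 : (0 < kappa)%R) (u_gt0 : (0 < u)%R) (u_le1 : (u <= 1)%R).
Hypothesis w_ge0 : (0 <= w)%R.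
Hypothesis concave_at_1 : forall t : R, (0 <= t <= 1)%R ->
  sigma kappa (1 - t) w * u%:E + sigma kappa t w <= 1.

Let a := (Num.sqrt kappa * w)%R.

(** Applied with [kappa = K / N], [u = U mu] and [w = W2 mu m]. The infinite value of [sigma] forces
    [a < pi]; below [pi], multiplying by [sin a > 0] gives the sine inequality. *)
Lemma sigma_concave_bound : (0 <= a < pi)%R /\ (u <= cos a)%R.
Proof.
have s0 : (0 < Num.sqrt kappa)%R by rewrite sqrtr_gt0.
have [wE|w0] := eqVneq w 0%R.
  by rewrite /a wE mulr0 cos0 lexx pi_gt0.
have {}w0 : (0 < w)%R by rewrite lt_neqAle eq_sym w0.
have a0 : (0 < a)%R by rewrite mulr_gt0.
have a2 : (kappa * w ^+ 2 = a ^+ 2)%R by rewrite exprMn sqr_sqrtr// ltW.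
have [hpi|hpi] := leP (pi ^+ 2)%R (kappa * w ^+ 2)%R.
  (* At the midpoint both coefficients are [+oo], and [u > 0], so the left side is [+oo] and cannot
     be at most 1. *)
  have := @concave_at_1 (2^-1)%R; rewrite /sigma (gt_eqF w0) hpi.
  rewrite gt0_mulye ?lte_fin// => h; suff: false by [].
  by apply: h; rewrite invr_ge0 ler0n invf_le1// ler1n.
have api : (a < pi)%R.
  by move: hpi; rewrite a2 ltr_sqr// nnegrE ?pi_ge0// ltW.
have sa : (0 < sin a)%R by rewrite sin_gt0_pi// a0.
split; first by rewrite (ltW a0).
apply: le_cos_of_sin_concavity => // t /andP[t0 t1].
have := @concave_at_1 t; rewrite (ltW t0) (ltW t1) => /(_ isT).
rewrite /sigma (gt_eqF w0) (leNgt (pi ^+ 2)%R) hpi /= -EFinM -EFinD lee_fin.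
have e s : (Num.sqrt kappa * s * w = s * a)%R by rewrite /a; ring.
by rewrite !e -/a mulrAC -mulrDl ler_pdivrMr// mul1r.
Qed.

(** [cos a >= u > 0 = cos (pi / 2)], and the cosine decreases strictly on [[0, pi]]. *)
Lemma sigma_concave_lt_pihalf : (a < pi / 2)%R.
Proof.
have [/andP[a0 api] ua] := sigma_concave_bound.
have pi2 : (0 <= (pi : R) / 2 <= pi)%R.
  by have := @pi_ge0 R; move: pi => p p0; apply/andP; split; lra.
by rewrite -ltr_cos ?in_itv/= ?a0 ?(ltW api)// cos_pihalf (lt_le_trans u_gt0).
Qed.

End distortion.

(** * Distance and entropy bounds for absolutely continuous measures *)

Section bounds.
Context {R : realType} {X : completeMetricType R}.
Hypothesis sepX : separable X.
Implicit Types (m P : probability (borel X) R).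

Lemma W2_Ent_of_CDe m (K N : R) (mu : {measure set (borel X) -> \bar R}) :
    (0 < K)%R -> (0 < N)%R -> CDe m K N -> P2 m -> P2star m mu ->
  W2 mu m <= (Num.sqrt (N / K) * (pi / 2))%:E /\
  - (N%:E * lne (cos (Num.sqrt (K / N) * fine (W2 mu m)))%:E) <= Ent m mu.
Proof.
move=> K0 N0 hCD p2m [p2mu Efin].
have [P PE] := probability_eq p2mu.1; rewrite -{}PE in p2mu Efin *.
have KN0 : (0 < K / N)%R by rewrite divr_gt0.
have U_le1 (nu : {measure set (borel X) -> \bar R}) : nu setT = 1 -> U m N nu <= 1.
  move=> nu1; rewrite /U -expeR0 lee_expeR oppe_le0 mule_ge0//.
    by rewrite lee_fin invr_ge0 ltW.
  exact: Ent_ge0.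
have Um : U m N m = 1 by rewrite /U Ent_self mule0 oppe0 expeR0.
have p2sm : P2star m m by split => //; rewrite Ent_self.
have [mut [_ _ _ mutP hmut]] := hCD P m (conj p2mu Efin) p2sm.
have Wfin := W2_fin_num sepX p2mu p2m.
have w0 : (0 <= fine (W2 P m))%R by rewrite fine_ge0// W2_ge0.
have WE := fineK Wfin; set w := fine (W2 P m) in hmut w0 WE *; rewrite -WE.
rewrite -(fineK Efin); set E := fine (Ent m P).
pose u := expR (- (N^-1 * E)).
have UP : U m N P = u%:E by rewrite /U -(fineK Efin).
(* Here [U m = 1], and [U (mu_t) <= 1] because the entropy is nonnegative. *)
have conc t : (0 <= t <= 1)%R -> sigma (K / N) (1 - t) w * u%:E + sigma (K / N) t w <= 1.
  move=> t01; have := hmut t t01; rewrite UP Um mule1 => /le_trans; apply.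
  by apply: U_le1; exact: (mutP t t01).1.1.
have u0 : (0 < u)%R by exact: expR_gt0.
have u1 : (u <= 1)%R by rewrite -lee_fin -UP; apply: U_le1; exact: probability_setT.
have [_ ucos] := sigma_concave_bound KN0 u0 u1 w0 conc.
have alt := sigma_concave_lt_pihalf KN0 u0 u1 w0 conc.
have s0 : (0 < Num.sqrt (K / N))%R by rewrite sqrtr_gt0.
split.
  (* [sqrt (N / K)] is the inverse of [sqrt (K / N)], so this is [alt] divided by the latter. *)
  rewrite lee_fin -(invf_div K N) sqrtrV; last exact: ltW.
  by rewrite mulrC ler_pdivlMr// mulrC ltW.
(* A positive cosine makes [lne] the real logarithm; since [ln u = - E / N], taking logarithms in
   [ucos] and multiplying by [N] gives the bound. *)
have c0 := lt_le_trans u0 ucos.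
rewrite lne_EFin// -EFinM -EFinN lee_fin.
have : (ln u <= ln (cos (Num.sqrt (K / N) * w)))%R by rewrite ler_ln.
rewrite expRK => /(ler_wpM2l (ltW N0)).
rewrite mulrN mulrA mulfV ?gt_eqF// mul1r.
by rewrite lerNl.
Qed.

Lemma density_cond m (mu : {measure set (borel X) -> \bar R}) rho
    (A : set (borel X)) (mA : measurable A) : density m mu rho ->
  density m (cond_measure mu mA) (fun x => (fine (mu A))^-1 * (rho x * \1_A x))%R.
Proof.
move=> [mrho rho0 rhoE].
have mr : measurable_fun setT (fun x => rho x * \1_A x)%R by exact: measurable_funM.
have r0 x : (0 <= rho x * \1_A x)%R by rewrite mulr_ge0.
have k0 := fine_measure_inv_ge0 mu A.
split; first exact: measurable_funM.
- by move=> x; rewrite mulr_ge0.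
- move=> B mB; rewrite cond_measureE (rhoE (B `&` A)); last exact: measurableI.
  under [in RHS]eq_integral do rewrite EFinM.
  rewrite ge0_integralZl_EFin//; last 2 first.
  - by move=> x _; rewrite lee_fin.
  - by apply/measurable_EFinP; exact: measurable_funTS.
  congr (_ * _); rewrite integral_mkcondr; apply: eq_integral => x _.
  by rewrite patchE indicE; case: ifP => _; rewrite ?mulr1 ?mulr0.
Qed.

Lemma P2_cond (mu : {measure set (borel X) -> \bar R})
    (A : set (borel X)) (mA : measurable A) : 0 < mu A < +oo -> P2 mu ->
  P2 (cond_measure mu mA).
Proof.
move=> A0 [mu1 [x0 hx0]]; split; first exact: cond_measureT.
exists x0; rewrite ge0_integral_cond_measure//; last 2 first.
- exact: measurable_sqr_mdist.
- by move=> x; rewrite lee_fin sqr_ge0.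
rewrite lte_mul_pinfty ?lee_fin ?fine_measure_inv_ge0//.
apply: le_lt_trans hx0; apply: ge0_subset_integral => //.
- exact: measurable_sqr_mdist.
- by move=> x _; rewrite lee_fin sqr_ge0.
Qed.

(** The Radon-Nikodym derivative supplied here is finite everywhere, so [fine] turns it into a
    real-valued density with the same integrals. *)
Lemma density_exists m P : P `<< m -> exists rho, density m P rho.
Proof.
move=> Pm; have [f [f0 ffin fint fE]] := radon_nikodym_sigma_finite Pm.
exists (fine \o f); split.
- by apply: measurableT_comp => //; exact: measurable_int fint.
- by move=> x; exact: fine_ge0.
- by move=> A mA; apply: etrans (fE A mA) _; apply: eq_integral => x _; rewrite /= fineK.
Qed.

Lemma W2_le_of_CDe m P (K N : R) : (0 < K)%R -> (0 < N)%R -> CDe m K N ->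
    P2 m -> P2 P -> P `<< m ->
  W2 P m <= (Num.sqrt (N / K) * (pi / 2))%:E.
Proof.
move=> K0 N0 hCD p2m p2P /density_exists[rho drho].
have [mrho rho0 _] := drho.
pose F (n : nat) : set (borel X) := [set x | (rho x <= n%:R)%R].
have mF n : measurable (F n).
  rewrite /F -(preimage_itvNyc rho) -[X in measurable X]setTI.
  exact: mrho (measurable_itv _).
apply: (W2_le_of_cond sepX (mF := mF) p2P p2m) => //.
- by rewrite mulr_ge0// divr_ge0// pi_ge0.
- move=> i j ij; apply/subsetPset => x; rewrite /F /= => /le_trans; apply.
  by rewrite ler_nat.
(* The sublevel sets exhaust the space because [rho] is real-valued; truncation rounds down, hence
   the successor. *)
- apply/seteqP; split => // x _; exists (Num.truncn (rho x)).+1 => //.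
  by rewrite /F /= ltW// truncnS_gt.
- move=> n PF0.
  have PFoo : P (F n) < +oo by rewrite ltey_eq fin_num_measure.
  apply: (W2_Ent_of_CDe K0 N0 hCD p2m _).1; split.
    by apply: P2_cond => //; rewrite PF0.
  (* The conditioned density is at most [n / P (F n)] on [F n] and 0 elsewhere. *)
  apply: (Ent_bounded (M := (fine (P (F n)))^-1 * n%:R) (density_cond (mF n) drho)).
  move=> x; rewrite ler_wpM2l ?fine_measure_inv_ge0// indicE.
  by case: (boolP (x \in F n)) => [/set_mem|_]; rewrite ?mulr1// mulr0.
Qed.

End bounds.

Theorem corollary3p29 (R : realType) (K N : R) (K_gt0 : (0 < K)%R)
    (N_gt0 : (0 < N)%R) (X : completeMetricType R) (sepX : separable X)
    (m : {measure set (borel X) -> \bar R})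
    (m_locally_finite : locally_finite m) (m_sigma_finite : sigma_finite setT m)
    (m_CDe : CDe m K N) (m_P2 : P2 m)
    (mu : {measure set (borel X) -> \bar R}) (mu_P2ac : P2ac m mu) :
  W2 mu m <= (Num.sqrt (N / K) * (pi / 2))%:E /\
  - (N%:E * lne (cos (Num.sqrt (K / N) * fine (W2 mu m)))%:E) <= Ent m mu.
Proof.
have [m' mE] := probability_eq m_P2.1; have [P PE] := probability_eq mu_P2ac.1.1.
rewrite -{}mE -{}PE in m_CDe m_P2 mu_P2ac *; have [p2P Pm] := mu_P2ac.
have [Efin|] := boolP (Ent m' P \is a fin_num).
  exact: (W2_Ent_of_CDe sepX K_gt0 N_gt0 m_CDe m_P2 (conj p2P Efin)).
(* Nonnegative entropy that is not finite equals [+oo]: the entropy bound is then trivial and only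
   the distance bound remains. *)
rewrite ge0_fin_numE; last by apply: Ent_ge0; exact: probability_setT.
rewrite ltey negbK => /eqP ->; split; last exact: leey.
exact: W2_le_of_CDe.
Qed.
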